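(* Let $\Delta$ be the root system of type $A_3$, realized in $V=\{x\in\mathbb{R}^4\mid x_1+x_2+x_3+x_4=0\}$ with simple coroots $\alpha_i^\vee=e_i-e_{i+1}$ ($i=1,2,3$), and let $I=\{1,3\}$, so that $\Delta^{*\vee}=\{e_i-e_j\mid 1\le i\le 2<j\le 4\}$. Write $t_{ij}$ for the variable $t_\alpha$ with $\alpha^\vee=e_i-e_j$ ($1\le i\le2<j\le4$). Let $\mathbf{y}=y_1\alpha_1^\vee+y_2\alpha_2^\vee+y_3\alpha_3^\vee$ with $y_j\in\mathbb{R}$, and $\lambda=m_1\lambda_1+m_3\lambda_3\in P_I$ with $m_1,m_3\in\mathbb{Z}$. Then the generating function $F(\mathbf{t}_I,\mathbf{y},\lambda;I;\Delta)$ equals, as a meromorphic function of $(t_{13},t_{23},t_{24},t_{14})$, \begin{align*} &\frac{t_{23}}{t_{23}-t_{13}+2\pi\sqrt{-1}m_1}\cdot\frac{t_{14}}{t_{14}-t_{13}-2\pi\sqrt{-1}m_3}\cdot\frac{t_{24}}{t_{24}-t_{13}-2\pi\sqrt{-1}(m_3-m_1)}\\ &\quad\times\exp\bigl(2\pi\sqrt{-1}(m_1(y_1-y_2)+m_3y_3)\bigr)\frac{t_{13}\exp(t_{13}\{y_2\})}{e^{t_{13}}-1}\\ &+\frac{t_{13}}{t_{13}-t_{23}-2\pi\sqrt{-1}m_1}\cdot\frac{t_{14}}{t_{14}-t_{23}-2\pi\sqrt{-1}(m_1+m_3)}\cdot\frac{t_{24}}{t_{24}-t_{23}-2\pi\sqrt{-1}m_3}\\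 &\quad\times\exp\bigl(2\pi\sqrt{-1}(m_1y_1+m_3y_3)\bigr)\frac{t_{23}\exp(t_{23}\{y_2\})}{e^{t_{23}}-1}\\ &+\frac{t_{13}}{t_{13}-t_{24}-2\pi\sqrt{-1}(m_1-m_3)}\cdot\frac{t_{14}}{t_{14}-t_{24}-2\pi\sqrt{-1}m_1}\cdot\frac{t_{23}}{t_{23}-t_{24}+2\pi\sqrt{-1}m_3}\\ &\quad\times\exp\bigl(2\pi\sqrt{-1}(m_1y_1+m_3(y_3-y_2))\bigr)\frac{t_{24}\exp(t_{24}\{y_2\})}{e^{t_{24}}-1}\\ &+\frac{t_{13}}{t_{13}-t_{14}+2\pi\sqrt{-1}m_3}\cdot\frac{t_{23}}{t_{23}-t_{14}+2\pi\sqrt{-1}(m_1+m_3)}\cdot\frac{t_{24}}{t_{24}-t_{14}+2\pi\sqrt{-1}m_1}\\ &\quad\times\exp\bigl(2\pi\sqrt{-1}(m_1(y_1-y_2)+m_3(y_3-y_2))\bigr)\frac{t_{14}\exp(t_{14}\{y_2\})}{e^{t_{14}}-1}, \end{align*} where $\{\cdot\}$ denotes the fractional part of a real number.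
   Context: Let $\Delta$ be a reduced root system of rank $r$ in an $r$-dimensional real inner product space $V$ with fundamental system $\Psi=\{\alpha_1,\dots,\alpha_r\}$, positive roots $\Delta_+$, coroots $\alpha^\vee$, coroot lattice $Q^\vee=\bigoplus_i\mathbb{Z}\alpha_i^\vee$, and fundamental weights $\lambda_j$ defined by $\langle\alpha_i^\vee,\lambda_j\rangle=\delta_{ij}$. For a set $A$ of roots, $A^\vee$ is the set of corresponding coroots. For $I\subset\{1,\dots,r\}$ put $\Psi_I=\{\alpha_i\mid i\in I\}$, $\Delta_I=\Delta\cap\mathrm{span}(\Psi_I)$, $\Delta_{I+}=\Delta_I\cap\Delta_+$, $P_I=\bigoplus_{i\in I}\mathbb{Z}\lambda_i$, $\Delta^*=\Delta_+\setminus\Delta_{I+}$, $d=|I^c|$. Let $\mathscr{V}_I$ be the set of all bases of $V$ of the form $\mathbf{V}=\mathbf{V}_I\cup\Psi_I$ with $\mathbf{V}_I\subset\Delta^*$, $|\mathbf{V}_I|=d$. For $\mathbf{V}\in\mathscr{V}_I$ let $L(\mathbf{V}^\vee)=\bigoplus_{\beta\in\mathbf{V}}\mathbb{Z}\beta^\vee\subset Q^\vee$, let $\{\mu^{\mathbf{V}}_\gamma\}_{\gamma\in\mathbf{V}}$ be the basis of $V$ dual to $\mathbf{V}^\vee$, and put $$p_{\mathbf{V}_I^\perp}(v)=v-\sum_{\gamma\in\mathbf{V}_I}\mu^{\mathbf{V}}_\gamma\langle\gamma^\vee,v\rangle\qquad(v\in V).$$ Fix an arbitrary non-zero $\phi\in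 V$ not lying in any hyperplane spanned by $r-1$ linearly independent coroots; then $\langle\phi,\mu^{\mathbf{V}}_\beta\rangle\neq0$ for all $\mathbf{V}\in\mathscr{V}_I$ and $\beta\in\mathbf{V}$. For $\mathbf{y}\in V$, $\beta\in\mathbf{V}$, set $\{\mathbf{y}\}_{\mathbf{V},\beta}=\{\langle\mathbf{y},\mu^{\mathbf{V}}_\beta\rangle\}$ if $\langle\phi,\mu^{\mathbf{V}}_\beta\rangle>0$ and $\{\mathbf{y}\}_{\mathbf{V},\beta}=1-\{-\langle\mathbf{y},\mu^{\mathbf{V}}_\beta\rangle\}$ if $\langle\phi,\mu^{\mathbf{V}}_\beta\rangle<0$, where $\{\cdot\}$ on the right is the usual fractional part. For $\mathbf{t}_I=(t_\alpha)_{\alpha\in\Delta^*}$ complex variables and $\lambda\in P_I$ the generating function is \begin{align*} F(\mathbf{t}_I,\mathbf{y},\lambda;I;\Delta)=\sum_{\mathbf{V}\in\mathscr{V}_I}&\Bigl(\prod_{\gamma\in\Delta^*\setminus\mathbf{V}_I}\frac{t_\gamma}{t_\gamma-\sum_{\beta\in\mathbf{V}_I}t_\beta\langle\gamma^\vee,\mu^{\mathbf{V}}_\beta\rangle-2\pi\sqrt{-1}\langle\gamma^\vee,p_{\mathbf{V}_I^\perp}(\lambda)\rangle}\Bigr)\\ &\times\frac{1}{|Q^\vee/L(\mathbf{V}^\vee)|}\sum_{q\in Q^\vee/L(\mathbf{V}^\vee)}\exp\bigl(2\pi\sqrt{-1}\langle\mathbf{y}+q,p_{\mathbf{V}_I^\perp}(\lambda)\rangle\bigr)\prod_{\beta\in\mathbf{V}_I}\frac{t_\beta\exp(t_\beta\{\mathbf{y}+q\}_{\mathbf{V},\beta})}{e^{t_\beta}-1}.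 \end{align*} *)

(* Defs.v *)
From HB Require Import structures.
From mathcomp Require Import all_boot all_order all_algebra perm finmap.
From mathcomp Require Import all_classical all_reals all_analysis.
From mathcomp Require Import complex ring.

Set Implicit Arguments.
Unset Strict Implicit.
Unset Printing Implicit Defensive.

Import Order.TTheory GRing.Theory Num.Theory.

Local Open Scope fset_scope.
Local Open Scope ring_scope.
Local Open Scope complex_scope.

Section Numbers.
Context {R : realType}.

Definition fracPart (x : R) : R := x - (Num.floor x)%:~R.

Definition cexp (z : R[i]) : R[i] :=
  expR (complex.Re z) * cos (complex.Im z)
    +i* (expR (complex.Re z) * sin (complex.Im z)).

Definition twopii : R[i] := 0 +i* (2 * pi).

End Numbers.

Section Lattices.
Context {R : realType} {n : nat}.
Local Notation E := 'rV[R]_n.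

Definition intSpan (A : {fset E}) : set E :=
  [set v | exists c : E -> int, v = \sum_(a <- A) a *~ c a].

Definition latCoset (L : set E) (q : E) : set E := [set x | L (x - q)].

(* The finite set of cosets; only meant for L of finite index in Q, as
   [fset_set] is empty on an infinite set. *)
Definition latCosets (Q L : set E) : {fset (set E)} :=
  fset_set [set latCoset L q | q in Q].

(* Some element of the coset c. *)
Definition cosetRepr (c : set E) : E := xget 0 c.

End Lattices.

Section Coroots.
Context {R : realType} {n : nat}.
Local Notation E := 'rV[R]_n.

Definition dot (u v : E) : R := \sum_i u ord0 i * v ord0 i.

Definition coroot (a : E) : E := (2 / dot a a) *: a.

Definition natComb (r : nat) (s : r.-tuple E) (v : E) : Prop :=
  exists c : 'I_r -> nat, v = \sum_(i < r) tnth s i *+ c i.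

End Coroots.

(* A reduced root system of rank r with a chosen fundamental system.  The
   r-dimensional inner product space V is a subspace [space] of R^n with the
   restriction of the standard inner product; any such V embeds like this. *)
Record rootSystem (R : realType) (n r : nat) := RootSystem {
  space : {vspace 'rV[R]_n};
  roots : {fset 'rV[R]_n};
  simple : r.-tuple 'rV[R]_n;
  roots_span : <<roots>>%VS = space;
  roots_neq0 : 0 \notin roots;
  roots_refl : {in roots &, forall a b, b - dot (coroot a) b *: a \in roots};
  roots_int : {in roots &, forall a b, dot (coroot a) b \is a Num.int};
  roots_reduced : forall a (c : R),
    a \in roots -> c *: a \in roots -> c = 1 \/ c = -1;
  simple_roots : {subset simple <= roots};
  simple_basis : basis_of space simple;
  simple_comb : {in roots, forall a, natComb simple a \/ natComb simple (- a)}
}.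

Section GeneratingFunction.
Context {R : realType} {n r : nat} (D : rootSystem R n r).
Local Notation E := 'rV[R]_n.
Local Notation C := R[i].

Definition posRoots : {fset E} :=
  [fset a in roots D | `[< natComb (simple D) a >]].

Definition corootLattice : set E :=
  intSpan [fset coroot (tnth (simple D) i) | i in 'I_r].

(* The element mu_b of the basis of V dual to the coroots of the basis B:
   it is the unique member of the set below when b \in B and B is a basis. *)
Definition dualVec (B : {fset E}) (b : E) : E :=
  xget 0 [set m : E | m \in space D /\
                      {in B, forall g, dot (coroot g) m = (g == b)%:R}].

Definition fundWeight (j : 'I_r) : E :=
  dualVec [fset tnth (simple D) i | i in 'I_r] (tnth (simple D) j).

(* phi <> 0 in V lies in no hyperplane spanned by r - 1 linearly independent
   coroots. *)
Definition admissible (phi : E) : Prop :=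
  [/\ phi \in space D, phi != 0 &
      forall s : seq E, size s = r.-1 ->
        {subset s <= [seq coroot a | a <- roots D]} -> free s ->
        phi \notin << s >>%VS].

Variable I : {set 'I_r}.

Definition PsiI : {fset E} := [fset tnth (simple D) i | i in I].

Definition rootsI : {fset E} := [fset a in roots D | a \in <<PsiI>>%VS].

(* Delta^* = Delta_+ \ Delta_{I+} *)
Definition rootsStar : {fset E} := posRoots `\` (rootsI `&` posRoots).

(* A basis V = V_I u Psi_I in the sum is represented by its part V_I, called
   A below; [full A] is V. *)
Definition full (A : {fset E}) : {fset E} := A `|` PsiI.

Definition bases : {fset {fset E}} :=
  [fset A in fpowerset rootsStar |
    (#|` A| == #|~: I|) && basis_of (space D) (full A)].

Definition sublattice (A : {fset E}) : set E :=
  intSpan [fset coroot b | b in full A].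

Definition projV (A : {fset E}) (v : E) : E :=
  v - \sum_(g <- A) dot (coroot g) v *: dualVec (full A) g.

Definition fracV (phi : E) (A : {fset E}) (b y : E) : R :=
  let mu := dualVec (full A) b in
  if 0 < dot phi mu then fracPart (dot y mu) else 1 - fracPart (- dot y mu).

(* A family (t_a) indexed by Delta^* is a function t on R^n of which only the
   values on Delta^* are used. *)
Definition denom (t : E -> C) (lam : E) (A : {fset E}) (g : E) : C :=
  t g - \sum_(b <- A) t b * (dot (coroot g) (dualVec (full A) b))%:C
      - twopii * (dot (coroot g) (projV A lam))%:C.

Definition genF (phi : E) (t : E -> C) (y lam : E) : C :=
  \sum_(A <- bases)
    (\prod_(g <- rootsStar `\` A) (t g / denom t lam A g)) *
    (1 / (#|` latCosets corootLattice (sublattice A)|)%:R *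
     \sum_(c <- latCosets corootLattice (sublattice A))
       (let q := cosetRepr c in
        cexp (twopii * (dot (y + q) (projV A lam))%:C) *
        \prod_(b <- A)
          (t b * cexp (t b * (fracV phi A b (y + q))%:C) / (cexp (t b) - 1)))).

(* t lies on none of the polar hyperplanes of the terms of the sum.  Each
   [denom] has coefficient 1 at the variable t_g, so the regular points form
   the complement of a locally finite union of affine hyperplanes: a connected
   dense open set, on which equality of functions is equality of meromorphic
   functions. *)
Definition regular (t : E -> C) (lam : E) : Prop :=
  forall A, A \in bases ->
    (forall g, g \in rootsStar `\` A -> denom t lam A g != 0) /\
    (forall b, b \in A -> cexp (t b) != 1).

End GeneratingFunction.

Section TypeA3.
Context {R : realType}.

(* The standard basis vectors e 1, ..., e 4 of R^4. *)
Definition e (k : nat) : 'rV[R]_4 := delta_mx ord0 (inord k.-1).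

Definition A3_space : {vspace 'rV[R]_4} :=
  lker (linfun (mulmxr (const_mx 1 : 'cV[R]_4))).

(* The simple coroots are prescribed as e_i - e_{i+1}; these vectors have
   squared length 2, so roots and coroots coincide (lemma A3_coroot). *)
Definition A3_roots : {fset 'rV[R]_4} :=
  [fset e p.1.+1 - e p.2.+1 | p : 'I_4 * 'I_4 in [pred p | p.1 != p.2]].

Definition A3_simple : 3.-tuple 'rV[R]_4 :=
  [tuple e 1 - e 2; e 2 - e 3; e 3 - e 4].

Lemma mem_A3_space (x : 'rV[R]_4) :
  (x \in A3_space) = (\sum_i x ord0 i == 0).
Proof.
rewrite memv_ker lfunE /=.
have -> : x *m const_mx 1 = (\sum_i x ord0 i)%:M.
  apply/matrixP=> i j; rewrite !ord1 !mxE eqxx mulr1n.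
  by apply: eq_bigr=> k _; rewrite mxE mulr1.
apply/eqP/eqP => [/matrixP/(_ ord0 ord0)|->]; last by rewrite raddf0.
by rewrite !mxE eqxx mulr1n.
Qed.

Lemma dotDr n (u v w : 'rV[R]_n) : dot u (v + w) = dot u v + dot u w.
Proof. by rewrite -big_split; apply: eq_bigr=> i _; rewrite mxE mulrDr. Qed.

Lemma dotC n (u v : 'rV[R]_n) : dot u v = dot v u.
Proof. by apply: eq_bigr=> i _; rewrite mulrC. Qed.

Lemma dotNr n (u v : 'rV[R]_n) : dot u (- v) = - dot u v.
Proof. by rewrite -sumrN; apply: eq_bigr=> i _; rewrite mxE mulrN. Qed.

Lemma dot_e (i j : 'I_4) : dot (e i.+1) (e j.+1) = (i == j)%:R.
Proof.
rewrite /dot /e /= !inord_val (bigD1 i) //= big1 ?addr0 => [|k ki].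
  by rewrite !mxE !eqxx mul1r.
by rewrite !mxE (negbTE ki) mul0r.
Qed.

Lemma A3_rootsP x :
  reflect (exists i j : 'I_4, i != j /\ x = e i.+1 - e j.+1) (x \in A3_roots).
Proof.
apply: (iffP (imfsetP _ _ _ _)) => [[[i j] /= ij ->]|[i [j [ij ->]]]].
  by exists i, j.
by exists (i, j).
Qed.

Lemma A3_coroot x : x \in A3_roots -> coroot x = x.
Proof.
case/A3_rootsP=> i [j [ij ->]]; rewrite /coroot.
rewrite !(dotDr, dotNr) !(dotC (_ - _)) !(dotDr, dotNr) !dot_e !eqxx.
by rewrite [j == i]eq_sym (negbTE ij) subr0 sub0r opprK divff ?scale1r.
Qed.


Lemma e_delta (i : 'I_4) : e i.+1 = delta_mx ord0 i.
Proof. by rewrite /e /= inord_val. Qed.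

Lemma eE k (i : 'I_4) : (0 < k <= 4)%N -> e k ord0 i = (i.+1 == k)%:R.
Proof.
case: k => // k /= k4; rewrite /e mxE eqxx /=; congr (_ %:R).
by rewrite eqSS -val_eqE /= inordK.
Qed.

Lemma A3_reflP : {in A3_roots &, forall a b,
  b - dot (coroot a) b *: a \in A3_roots}.
Proof.
move=> a b ra; rewrite (A3_coroot ra).
case/A3_rootsP: ra => i [j [ij ->]] /A3_rootsP[k [l [kl ->]]].
have refl_e (m : 'I_4) : e m.+1 - dot (e i.+1 - e j.+1) (e m.+1) *: (e i.+1 - e j.+1)
    = e (tperm i j m).+1.
  rewrite dotC dotDr dotNr !dot_e; case: tpermP => [->|->|/eqP mi /eqP mj].
  - by rewrite eqxx (negbTE ij) subr0 scale1r opprB addrC subrK.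
  - by rewrite eqxx eq_sym (negbTE ij) sub0r scaleN1r opprK addrC subrK.
  - by rewrite (negbTE mi) (negbTE mj) subrr scale0r subr0.
apply/A3_rootsP; exists (tperm i j k), (tperm i j l).
split; first by rewrite (inj_eq perm_inj).
rewrite -!refl_e dotDr dotNr scalerBl; set w := e i.+1 - e j.+1.
by rewrite opprB [in RHS]opprB addrACA [RHS]addrACA [- e l.+1 - _]addrC.
Qed.

Lemma A3_intP : {in A3_roots &, forall a b, dot (coroot a) b \is a Num.int}.
Proof.
move=> a b ra; rewrite (A3_coroot ra).
case/A3_rootsP: ra => i [j [ij ->]] /A3_rootsP[k [l [kl ->]]].
rewrite !(dotDr, dotNr) !(dotC (_ - _)) !(dotDr, dotNr) !dot_e.
by rewrite !(rpredD, rpredN) // rpred_nat.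
Qed.

Lemma A3_neq0 : 0 \notin A3_roots.
Proof.
apply/A3_rootsP=> -[i [j [ij /rowP/(_ i)]]].
rewrite !e_delta !mxE !eqxx (negbTE ij) subr0 => /eqP.
by rewrite eq_sym oner_eq0.
Qed.

Lemma A3_reducedP a (c : R) :
  a \in A3_roots -> c *: a \in A3_roots -> c = 1 \/ c = -1.
Proof.
have [->|c0] := eqVneq c 0; first by rewrite scale0r (negbTE A3_neq0).
case/A3_rootsP=> i [j [ij ->]] /A3_rootsP[k [l [kl /rowP/(_ i)]]].
rewrite !e_delta !mxE !eqxx (negbTE ij) /= subr0 mulr1 => cE.
move: c0; rewrite cE; have [ik|ik] := eqVneq i k; have [il|il] := eqVneq i l.
- by rewrite subrr eqxx.
- by rewrite subr0; left.
- by rewrite sub0r; right.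
- by rewrite subrr eqxx.
Qed.

Lemma A3_simple_roots : {subset A3_simple <= A3_roots}.
Proof.
have rS (i j : 'I_4) : i != j -> e i.+1 - e j.+1 \in A3_roots.
  by move=> ij; apply/A3_rootsP; exists i, j.
move=> x; rewrite !inE => /or3P[] /eqP->.
- exact: (rS (@Ordinal 4 0 isT) (@Ordinal 4 1 isT)).
- exact: (rS (@Ordinal 4 1 isT) (@Ordinal 4 2 isT)).
- exact: (rS (@Ordinal 4 2 isT) (@Ordinal 4 3 isT)).
Qed.

Lemma A3_roots_space : {subset A3_roots <= A3_space}.
Proof.
move=> x /A3_rootsP[i [j [_ ->]]]; rewrite mem_A3_space !e_delta.
under eq_bigr do rewrite !mxE /=.
rewrite sumrB (bigD1 i) //= eqxx big1 ?addr0 => [|k /negbTE-> //].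
by rewrite (bigD1 j) //= eqxx big1 ?addr0 ?subrr // => k /negbTE->.
Qed.

Lemma A3_space_comb (x : 'rV[R]_4) : x \in A3_space ->
  x = x ord0 (inord 0) *: (e 1 - e 2)
    + (x ord0 (inord 0) + x ord0 (inord 1)) *: (e 2 - e 3)
    + (x ord0 (inord 0) + x ord0 (inord 1) + x ord0 (inord 2)) *: (e 3 - e 4).
Proof.
rewrite mem_A3_space !big_ord_recl big_ord0 addr0 => /eqP x0.
have i0 : inord 0 = ord0 :> 'I_4 by apply/val_inj; rewrite /= inordK.
have i1 : inord 1 = lift ord0 ord0 :> 'I_4 by apply/val_inj; rewrite /= inordK.
have i2 : inord 2 = lift ord0 (lift ord0 ord0) :> 'I_4.
  by apply/val_inj; rewrite /= inordK.
rewrite i0 i1 i2; set a := x _ _ in x0 *; set b := x _ _ in x0 *.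
set c := x _ _ in x0 *; set d := x _ _ in x0 *.
have dE : d = - (a + b + c) by apply/eqP; rewrite -addr_eq0 -x0; apply/eqP; ring.
apply/rowP => i; rewrite !(eE, mxE) //.
case: i => [[|[|[|[|//]]]]] ? /=.
- rewrite (_ : x _ _ = a); last by congr (x _ _); apply/val_inj.
  by ring.
- rewrite (_ : x _ _ = b); last by congr (x _ _); apply/val_inj.
  by ring.
- rewrite (_ : x _ _ = c); last by congr (x _ _); apply/val_inj.
  by ring.
- rewrite (_ : x _ _ = d); last by congr (x _ _); apply/val_inj.
  by rewrite dE; ring.
Qed.

Lemma A3_simple_basis : basis_of A3_space A3_simple.
Proof.
rewrite /basis_of; apply/andP; split; last first.
  apply/freeP => k; rewrite !big_ord_recl big_ord0 /= addr0 => /rowP k0.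
  have := k0 (@Ordinal 4 0 isT); have := k0 (@Ordinal 4 1 isT).
  have := k0 (@Ordinal 4 2 isT); rewrite !(eE, mxE) //= => k2 k1 k00.
  have {}k00 : k ord0 = 0 by rewrite -[RHS]k00; ring.
  have {}k1 : k (lift ord0 ord0) = 0 by rewrite -[RHS]k1 k00; ring.
  have {}k2 : k (lift ord0 (lift ord0 ord0)) = 0 by rewrite -[RHS]k2 k1; ring.
  case=> [[|[|[|//]]]] ?; [rewrite -k00|rewrite -k1|rewrite -k2];
    congr (k _); exact/val_inj.
rewrite eqEsubv; apply/andP; split.
  by apply/span_subvP => x /A3_simple_roots/A3_roots_space.
apply/subvP => x /A3_space_comb->.
by rewrite !rpredD // rpredZ // memv_span // !inE eqxx ?orbT.
Qed.

Lemma A3_roots_span : <<A3_roots>>%VS = A3_space.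
Proof.
apply/eqP; rewrite eqEsubv; apply/andP; split.
  by apply/span_subvP => x /A3_roots_space.
rewrite -(span_basis A3_simple_basis); apply: sub_span.
exact: A3_simple_roots.
Qed.

Lemma A3_simple_comb :
  {in A3_roots, forall a, natComb A3_simple a \/ natComb A3_simple (- a)}.
Proof.
suff H (i j : 'I_4) : (i < j)%N -> natComb A3_simple (e i.+1 - e j.+1).
  move=> a /A3_rootsP[i [j [ij ->]]]; rewrite opprB.
  have [lij|lji|/val_inj eij] := ltngtP i j; [left|right|].
  - exact: H.
  - exact: H.
  - by rewrite eij eqxx in ij.
move=> ij; exists (fun k : 'I_3 => (i <= k < j)%N : nat).
rewrite !big_ord_recl big_ord0 /= addr0.
case: i j ij => [[|[|[|[|//]]]] ?] [[|[|[|[|//]]]] ?] //= _;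
  rewrite ?mulr1n ?mulr0n ?addr0 ?add0r ?addrA ?subrK //.
Qed.

Definition A3 : rootSystem R 4 3 :=
  RootSystem A3_roots_span A3_neq0 A3_reflP A3_intP A3_reducedP
    A3_simple_roots A3_simple_basis A3_simple_comb.

(* I = {1, 3}: the simple roots are numbered from 0 here. *)
Definition A3_I : {set 'I_3} := [set ord0; ord_max]%SET.

End TypeA3.

(* Main.v *)
Require Import Defs.
From mathcomp Require Import all_boot all_order all_algebra finmap.
From mathcomp Require Import all_classical all_reals all_analysis.
From mathcomp Require Import complex ring.

Import Order.TTheory GRing.Theory Num.Theory.

Local Open Scope ring_scope.
Local Open Scope complex_scope.

(** Since I^c is a singleton, a basis V is Psi_I together with a single root b
    of Delta^*, and all four choices of b give one ([mem_bases]).  Each b has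
    coefficient 1 at the second simple root, which has two consequences.  First,
    the coroots of V generate the whole coroot lattice, so the inner sum has one
    term, and the choice of the representative of the trivial coset does not
    matter ([genF_star]).  Secondly, the vector of the dual basis attached to b
    is the fundamental weight lambda_2 for every b ([dualVec_star]).  Hence the
    denominators are differences s_g - s_b of the numbers
    s_g = t_g - 2 pi i <g, lam> ([denom_star]), and the sum takes the asserted
    form, except that {y2} is replaced by 1 - {-y2} if <phi, lambda_2> is not
    positive.

    The two conventions agree for non-integral y2.  For integral y2 the factors
    cexp (2 pi i <y, p(lam)>) take one value E for all b, and passing from
    exponent 0 to exponent 1 changes the sum by
    E * (prod_g t_g) * sum_b prod_(g != b) 1 / (s_g - s_b), which is zero by
    partial fractions ([starSum01]). *)

(** * Fractional parts and the complex exponential *)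

Section Numbers.
Context {R : realType}.
Implicit Types (x : R) (n : int) (z w : R[i]).

Lemma fracPartDint x n : fracPart (x + n%:~R) = fracPart x.
Proof.
rewrite /fracPart floorDrz ?rpred_int // intrKfloor intrD.
by rewrite opprD addrACA subrr addr0.
Qed.

Lemma fracPart_int n : fracPart (n%:~R : R) = 0.
Proof. by rewrite /fracPart intrKfloor subrr. Qed.

Lemma fracPartN x : x \isn't a Num.int -> 1 - fracPart (- x) = fracPart x.
Proof.
move=> xNint; rewrite /fracPart.
have -> : Num.floor (- x) = - (Num.floor x + 1).
  apply: floor_def; rewrite opprD subrK -opprD !rmorphN lerN2 ltrN2.
  by rewrite ltW ?floorD1_gt //= lt_neqAle floor_le -intrEfloor xNint.
by rewrite rmorphN rmorphD /=; ring.
Qed.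

Lemma cexpD z w : cexp (z + w) = cexp z * cexp w.
Proof.
case: z w => [a b] [c d]; rewrite /cexp; simpc => /=.
by rewrite expRD cosD sinD; congr (_ +i* _); ring.
Qed.

Lemma cexp0 : cexp 0 = 1 :> R[i].
Proof. by rewrite /cexp /= expR0 cos0 sin0 mulr1 mulr0. Qed.

Lemma cexp_twopii_int n : cexp (twopii * n%:~R : R[i]) = 1.
Proof.
have cexp1 : cexp twopii = 1 :> R[i].
  by rewrite /cexp /twopii /= mulr_natl cos2pi sin2pi expR0 mulr1 mulr0.
have cexpn (k : nat) : cexp (twopii * k%:R : R[i]) = 1.
  elim: k => [|k IH]; first by rewrite mulr0 cexp0.
  by rewrite -addn1 natrD mulrDr mulr1 cexpD IH cexp1 mul1r.
case: n => k; first exact: cexpn.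
rewrite NegzE rmorphN mulrN -[LHS]mul1r -{1}(cexpn k.+1) -cexpD.
by rewrite subrr cexp0.
Qed.

Lemma cexp_twopiiDint x n :
  cexp (twopii * (x + n%:~R)%:C) = cexp (twopii * x%:C).
Proof.
by rewrite rmorphD /= mulrDr cexpD rmorph_int cexp_twopii_int mulr1.
Qed.

End Numbers.

(** * Partial fractions *)

Lemma uniq4_sum_prod (S : nzSemiRingType) (T : eqType) (a b c d : T)
    (F : T -> T -> S) (G : T -> S) : uniq [:: a; b; c; d] ->
  \sum_(x <- [:: a; b; c; d])
     (\prod_(g <- [:: a; b; c; d] | g != x) F g x) * G x =
  F b a * F c a * F d a * G a + F a b * F c b * F d b * G b
  + F a c * F b c * F d c * G c + F a d * F b d * F c d * G d.
Proof.
rewrite /= !inE !negb_or => /and4P[/and3P[ab ac ad] /andP[bc bd] cd _].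
rewrite !big_cons !big_nil !eqxx (eq_sym b a) (eq_sym c a) (eq_sym d a).
rewrite (eq_sym c b) (eq_sym d b) (eq_sym d c) ab ac ad bc bd cd /=.
by rewrite !mulr1 !mulrA addr0 !addrA.
Qed.

(** Up to sign, the sum is the third divided difference of the constant function
    [E * t a * t b * t c * t d] at the four nodes [s a], [s b], [s c], [s d]. *)
Lemma sum_partial_fractions4 {F : fieldType} {T : eqType} (a b c d : T)
    (t s : T -> F) (E : F) :
  uniq [:: a; b; c; d] -> {in [:: a; b; c; d] &, injective s} ->
  \sum_(x <- [:: a; b; c; d])
     (\prod_(g <- [:: a; b; c; d] | g != x) (t g / (s g - s x))) * (E * t x)
  = 0.
Proof.
move=> u sinj; rewrite uniq4_sum_prod //.
have sD x y : x \in [:: a; b; c; d] -> y \in [:: a; b; c; d] ->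
    x != y -> s x - s y != 0.
  by move=> xS yS; rewrite subr_eq0; apply: contra => /eqP/sinj->.
move: u; rewrite /= !inE !negb_or.
move=> /and4P[/and3P[ab ac ad] /andP[bc bd] cd _].
by field; rewrite !sD ?inE ?eqxx ?orbT // eq_sym.
Qed.

(** * Lattices and dual vectors *)

Section Lattices.
Context {R : realType} {n : nat}.
Implicit Types (A B : {fset 'rV[R]_n}) (u v : 'rV[R]_n).

Lemma intSpanD A u v : intSpan A u -> intSpan A v -> intSpan A (u + v).
Proof.
move=> [c ->] [d ->]; exists (fun a => c a + d a).
by rewrite -big_split; apply: eq_bigr => a _; rewrite mulrzDr.
Qed.

Lemma intSpanMz A u (k : int) : intSpan A u -> intSpan A (u *~ k).
Proof.
move=> [c ->]; exists (fun a => c a * k).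
by rewrite mulrz_suml; apply: eq_bigr => a _; rewrite mulrzA.
Qed.

Lemma intSpan_gen A u : u \in A -> intSpan A u.
Proof.
move=> uA; exists (fun a => (a == u)%:Z).
rewrite (big_fsetD1 u) //= eqxx mulr1z big_seq big1 ?addr0 // => a.
by rewrite !inE => /andP[/negbTE-> _]; rewrite mulr0z.
Qed.

Lemma intSpan_le A B :
  (forall a, a \in A -> intSpan B a) -> (intSpan A `<=` intSpan B)%classic.
Proof.
move=> AB v [c ->]; rewrite big_seq; apply: big_ind => [|u w|a /AB].
- by exists (fun=> 0); rewrite big1.
- exact: intSpanD.
- exact: intSpanMz.
Qed.

Lemma latCosets_self A :
  latCosets (intSpan A) (intSpan A) = [fset intSpan A]%fset.
Proof.
have coset q : intSpan A q -> latCoset (intSpan A) q = intSpan A.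
  move=> Aq; apply/seteqP; split => x /= => [xq|Ax].
    by rewrite -[x](subrK q); apply: intSpanD.
  by apply: intSpanD => //; rewrite -mulrN1z; apply: intSpanMz.
rewrite /latCosets -fset_set1; congr fset_set.
apply/seteqP; split=> [_ [q Aq <-]|_ ->] /=; first exact: coset.
exists 0; last by apply: coset; exists (fun=> 0); rewrite big1.
by exists (fun=> 0); rewrite big1.
Qed.

End Lattices.

Section Dot.
Context {R : realType} {n : nat}.
Implicit Types (u v w : 'rV[R]_n) (k : R).

Lemma dotZr k u v : dot u (k *: v) = k * dot u v.
Proof.
by rewrite /dot mulr_sumr; apply: eq_bigr => i _; rewrite mxE mulrCA.
Qed.

Lemma dotDl u v w : dot (u + v) w = dot u w + dot v w.
Proof. by rewrite dotC dotDr !(dotC w). Qed.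

Lemma dotNl u v : dot (- u) v = - dot u v.
Proof. by rewrite dotC dotNr dotC. Qed.

Lemma dotZl k u v : dot (k *: u) v = k * dot u v.
Proof. by rewrite dotC dotZr dotC. Qed.

Lemma dot0l v : dot 0 v = 0.
Proof. by rewrite -(scale0r 0) dotZl mul0r. Qed.

Lemma dot_eq0 v : (dot v v == 0) = (v == 0).
Proof.
apply/eqP/eqP => [v0|->]; last exact: dot0l.
apply/rowP => i; rewrite mxE; apply/eqP; rewrite -sqrf_eq0 expr2.
move/eqP: v0; rewrite psumr_eq0 => [/allP/(_ i)|j _]; last first.
  by rewrite -expr2 sqr_ge0.
by rewrite mem_index_enum => /(_ isT).
Qed.

Lemma dot_coroot_eq0 u v : dot (coroot u) v = 0 -> dot u v = 0.
Proof.
have [->|u0] := eqVneq u 0; first by rewrite dot0l.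
rewrite dotZl => /eqP; rewrite mulf_eq0 mulf_eq0 invr_eq0 dot_eq0 (negbTE u0).
by rewrite pnatr_eq0 /= => /eqP.
Qed.

Lemma dot_span0 (s : seq 'rV[R]_n) u v :
  {in s, forall w, dot w v = 0} -> u \in << s >>%VS -> dot u v = 0.
Proof.
move=> s0 us; have {us} := coord_span (X := in_tuple s) us => ->.
apply: (big_ind (fun u => dot u v = 0)) => [|x y x0 y0|i _]; first exact: dot0l.
  by rewrite dotDl x0 y0 addr0.
by rewrite dotZl s0 ?mulr0 // mem_nth.
Qed.

End Dot.

(** Two members of the set defining [dualVec] differ by a vector of the space
    that is orthogonal to a spanning set of it, hence to itself. *)
Lemma dualVecE {R : realType} {n r : nat} (D : rootSystem R n r)
    (B : {fset 'rV[R]_n}) (b m : 'rV[R]_n) :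
  (Defs.space D <= << B >>)%VS -> m \in Defs.space D ->
  {in B, forall g, dot (coroot g) m = (g == b)%:R} -> dualVec D B b = m.
Proof.
move=> DB mD mB; apply: xget_subset1 => //.
move=> u v [uD uB] [vD vB]; apply/eqP; rewrite -subr_eq0 -dot_eq0; apply/eqP.
apply: (@dot_span0 _ _ B) => [g gB|].
  by apply: dot_coroot_eq0; rewrite dotDr dotNr uB // vB // subrr.
by rewrite (subvP DB) ?rpredB.
Qed.

(** * Positive roots and weights in type A3 *)

Section TypeA3.
Context {R : realType}.
Local Notation D := (@A3 R).
Local Notation I := A3_I.
Implicit Types (i j k : nat) (x y b g q phi lam : 'rV[R]_4).
Implicit Types (t : 'rV[R]_4 -> R[i]).

(** The projection of [e 1 + ... + e k] to the hyperplane of zero coordinate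
    sum: for [k = 1, 2, 3] this is the k-th fundamental weight. *)
Definition weight k : 'rV[R]_4 := \row_i ((i < k)%:R - k%:R / 4).

Lemma weight_space k : (k <= 4)%N -> weight k \in A3_space.
Proof.
case: k => [|[|[|[|[|//]]]]] _;
  rewrite mem_A3_space !big_ord_recl big_ord0 !mxE /=;
  by apply/eqP; field.
Qed.

Lemma dot_e_weight i k : (0 < i <= 4)%N ->
  dot (e i) (weight k) = (i <= k)%:R - k%:R / 4.
Proof.
case: i => // i /= i4; rewrite /dot (e_delta (Ordinal i4)).
rewrite (bigD1 (Ordinal i4)) //= big1 => [|l li];
  rewrite !mxE ?eqxx ?(negbTE li).
  by rewrite mul1r addr0.
by rewrite mul0r.
Qed.

Lemma dot_root_weight i j k : (0 < i <= 4)%N -> (0 < j <= 4)%N ->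
  dot (e i - e j) (weight k) = (i <= k)%:R - (j <= k)%:R.
Proof.
by move=> i4 j4; rewrite dotDl dotNl !dot_e_weight // opprB addrA subrK.
Qed.

(** Pairing with [weight j.+1], which is nonnegative on the simple roots, rules
    out [j < i]. *)
Lemma natComb_root (i j : 'I_4) :
  natComb A3_simple (e i.+1 - e j.+1 : 'rV[R]_4) -> (i <= j)%N.
Proof.
move=> [c xE]; rewrite leqNgt; apply/negP => ji.
suff: 0 <= dot (e i.+1 - e j.+1) (weight j.+1).
  rewrite dot_root_weight ?ltn_ord // leqnn leqNgt ltnS ji sub0r.
  by rewrite oppr_ge0 lern0.
rewrite xE; apply: (big_ind (fun x => 0 <= dot x _)) => [|u v u0 v0|l _].
- by rewrite dot0l.
- by rewrite dotDl addr_ge0.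
rewrite -scaler_nat dotZl mulr_ge0 //.
case: l => [[|[|[|//]]]] l3; rewrite (tnth_nth 0) /= dot_root_weight //
  subr_ge0 ler_nat; by case: (j : nat) => [|[|[|]]].
Qed.

Lemma mem_posRoots (i j : 'I_4) :
  ((e i.+1 - e j.+1 : 'rV[R]_4) \in posRoots D) = (i < j)%N.
Proof.
apply/idP/idP => [|ij].
  rewrite !inE /= => /andP[rij /asboolP/natComb_root].
  rewrite leq_eqVlt => /predU1P[/val_inj eij|//].
  by move: rij; rewrite eij subrr (negbTE A3_neq0).
have rij : e i.+1 - e j.+1 \in @A3_roots R.
  apply/A3_rootsP; exists i, j; split => //.
  by apply: contraTneq ij => ->; rewrite ltnn.
rewrite !inE rij; apply/asboolP.
have [//|] := A3_simple_comb rij.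
by rewrite opprB => /natComb_root; rewrite leqNgt ij.
Qed.

(** * The roots of Delta^* and the bases *)

(** The roots of Delta^*, in the order of the summands of the theorem. *)
Definition starRoots : seq 'rV[R]_4 :=
  [:: e 1 - e 3; e 2 - e 3; e 2 - e 4; e 1 - e 4].

Lemma starRootsP x : x \in starRoots ->
  [\/ x = e 1 - e 3, x = e 2 - e 3, x = e 2 - e 4 | x = e 1 - e 4].
Proof.
rewrite !inE => /or4P[] /eqP.
by constructor 1. by constructor 2. by constructor 3. by constructor 4.
Qed.

Lemma A3_simpleP x : x \in @A3_simple R ->
  [\/ x = e 1 - e 2, x = e 2 - e 3 | x = e 3 - e 4].
Proof.
by rewrite !inE => /or3P[] /eqP; [constructor 1|constructor 2|constructor 3].
Qed.

Lemma mem_PsiI x : (x \in PsiI D I) = (x \in [:: e 1 - e 2; e 3 - e 4]).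
Proof.
rewrite !inE; apply/imfsetP/orP => /= [[l]|].
  by rewrite !inE => /orP[] /eqP-> ->; rewrite (tnth_nth 0) /= eqxx;
    [left|right].
by case=> /eqP->; [exists ord0|exists ord_max]; rewrite ?inE ?eqxx ?orbT //
  (tnth_nth 0).
Qed.

Lemma starRoots_uniq : uniq starRoots.
Proof.
apply: (@map_uniq _ _ (fun x => (dot x (weight 1), dot x (weight 3)))).
rewrite /= !dot_root_weight //= !subr0 !subrr !inE !xpair_eqE !eqxx.
by rewrite ![0 == 1]eq_sym !oner_eq0.
Qed.

(** [weight 2] separates Delta_I, where it vanishes, from Delta^*, where it
    takes the value 1. *)
Lemma dot_rootsI_weight2 x : x \in rootsI D I -> dot x (weight 2) = 0.
Proof.
rewrite !inE => /andP[_]; apply: dot_span0 => b; rewrite mem_PsiI !inE.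
by case/orP=> /eqP->; rewrite dot_root_weight //= subrr.
Qed.

Lemma mem_rootsStar x : (x \in rootsStar D I) = (x \in starRoots).
Proof.
apply/idP/idP.
  rewrite in_fsetD in_fsetI => /andP[xI xpos].
  have xD : x \in @A3_roots R by move: xpos; rewrite !inE => /andP[].
  have /A3_rootsP[i [j [_ xE]]] := xD.
  have ij : (i < j)%N by rewrite -mem_posRoots -xE.
  have {}xI : x \notin PsiI D I.
    by apply: contra xI => xI; rewrite xpos !inE xD memv_span.
  move: ij xI; rewrite mem_PsiI {xD xpos}xE.
  by case: i => [[|[|[|[|//]]]] ?]; case: j => [[|[|[|[|//]]]] ?] //= _;
    rewrite !inE /= eqxx ?orbT.
move=> xS; rewrite in_fsetD in_fsetI negb_and; apply/andP; split.
  apply/orP; left; apply/negP => /dot_rootsI_weight2.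
  by case/starRootsP: xS => ->; rewrite dot_root_weight //= subr0 => /eqP;
    rewrite oner_eq0.
have pos (k l : 'I_4) :
    (k < l)%N -> (e k.+1 - e l.+1 : 'rV[R]_4) \in posRoots D.
  by rewrite mem_posRoots.
case/starRootsP: xS => ->.
- exact: (pos (@Ordinal 4 0 isT) (@Ordinal 4 2 isT) isT).
- exact: (pos (@Ordinal 4 1 isT) (@Ordinal 4 2 isT) isT).
- exact: (pos (@Ordinal 4 1 isT) (@Ordinal 4 3 isT) isT).
- exact: (pos (@Ordinal 4 0 isT) (@Ordinal 4 3 isT) isT).
Qed.

Lemma perm_rootsStar : perm_eq (rootsStar D I) starRoots.
Proof.
apply: uniq_perm; first exact: fset_uniq; first exact: starRoots_uniq.
exact: mem_rootsStar.
Qed.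

Lemma starRoots_root b : b \in starRoots -> b \in @A3_roots R.
Proof. by rewrite -mem_rootsStar !inE => /andP[_ /andP[]]. Qed.

Lemma full_root b :
  b \in starRoots -> {subset full D I [fset b]%fset <= @A3_roots R}.
Proof.
move=> bS x; rewrite !inE => /orP[/eqP->|]; first exact: starRoots_root.
by rewrite mem_PsiI !inE => /orP[] /eqP->; apply: A3_simple_roots;
  rewrite !inE eqxx ?orbT.
Qed.

(** Each root of Delta^* has coefficient 1 at the second simple root, so that
    together with the two simple roots of [A3_I] it generates over the integers
    the lattice of all coroots. *)
Lemma starRoots_simple b : b \in starRoots ->
  exists k1 k3 : int, e 2 - e 3 = b + (e 1 - e 2) *~ k1 + (e 3 - e 4) *~ k3.
Proof.
case/starRootsP => ->;
  [exists (-1), 0|exists 0, 0|exists 0, (-1)|exists (-1), (-1)];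
  rewrite ?mulrN1z ?mulr0z ?addr0 //; apply/rowP => i; rewrite !mxE; ring.
Qed.

Lemma full_span b :
  b \in starRoots -> (A3_space <= << full D I [fset b]%fset >>)%VS.
Proof.
move=> bS; rewrite -(span_basis A3_simple_basis); apply/span_subvP => x.
have fullS z :
    z \in full D I [fset b]%fset -> z \in << full D I [fset b]%fset >>%VS.
  exact: memv_span.
have S1 : e 1 - e 2 \in << full D I [fset b]%fset >>%VS.
  by apply: fullS; rewrite in_fsetU mem_PsiI !inE eqxx orbT.
have S3 : e 3 - e 4 \in << full D I [fset b]%fset >>%VS.
  by apply: fullS; rewrite in_fsetU mem_PsiI !inE eqxx !orbT.
have Sb : b \in << full D I [fset b]%fset >>%VS.
  by apply: fullS; rewrite !inE eqxx.
have [k1 [k3 e23]] := starRoots_simple _ bS.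
clear fullS; move: (<< _ >>%VS) S1 S3 Sb => W S1 S3 Sb.
case/A3_simpleP => ->; [exact: S1|rewrite e23|exact: S3].
by do 2?apply: rpredD; [exact: Sb|exact: rpredMz S1|exact: rpredMz S3].
Qed.

Lemma mem_bases (A : {fset 'rV[R]_4}) :
  reflect (exists2 b, b \in starRoots & A = [fset b]%fset) (A \in bases D I).
Proof.
have cI : #|~: I| = 1%N.
  by rewrite cardsCs finset.setCK cards2 card_ord.
rewrite !inE fpowersetE cI /=; apply: (iffP and3P) => [[AS /cardfs1P[b AE] _]|].
  exists b => //; rewrite -mem_rootsStar; apply: (fsubsetP AS).
  by rewrite AE inE.
move=> [b bS ->]; rewrite cardfs1 fsub1set mem_rootsStar bS; split=> //.
rewrite basisEdim full_span //=.
rewrite (size_basis A3_simple_basis).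
apply: (@uniq_leq_size _ _ [:: b; e 1 - e 2; e 3 - e 4]).
  exact: fset_uniq.
by move=> x; rewrite in_fsetU mem_PsiI !inE.
Qed.

(** * The summands of the generating function *)

Lemma dot_starRoots_weight2 b : b \in starRoots -> dot b (weight 2) = 1.
Proof. by case/starRootsP => ->; rewrite dot_root_weight //= subr0. Qed.

Lemma fundWeight_A3 (l : 'I_3) : fundWeight D l = weight l.+1.
Proof.
apply: dualVecE => [||g].
- rewrite -(span_basis (simple_basis D)); apply: sub_span => x /tnthP[k ->].
  by apply/imfsetP; exists k.
- by apply: weight_space; rewrite ltnW // ltnS.
case/imfsetP => k _ ->; rewrite (A3_coroot (A3_simple_roots (mem_tnth _ _))).
have -> : (tnth (simple D) k == tnth (simple D) l) = (k == l).
  rewrite !(tnth_nth 0) nth_uniq ?size_tuple //.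
  exact: free_uniq (basis_free A3_simple_basis).
case: l => [[|[|[|//]]] ?]; case: k => [[|[|[|//]]] ?]; rewrite (tnth_nth 0) /=
  dot_root_weight // ?subrr ?subr0 //.
Qed.

(** The dual vector is the same for all four bases: [weight 2] vanishes on the
    simple roots of [A3_I] and is 1 on Delta^*. *)
Lemma dualVec_star b : b \in starRoots ->
  dualVec D (full D I [fset b]%fset) b = weight 2.
Proof.
move=> bS; apply: dualVecE => [||g gV]; [exact: full_span|exact: weight_space|].
rewrite (A3_coroot (full_root _ bS _ gV)); move: gV; rewrite in_fsetU in_fset1.
have [->|gb] := eqVneq; first by rewrite dot_starRoots_weight2.
by rewrite /= mem_PsiI !inE => /orP[] /eqP->; rewrite dot_root_weight //= subrr.
Qed.

Lemma projV_star b lam : b \in starRoots ->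
  projV D I [fset b]%fset lam = lam - dot b lam *: weight 2.
Proof.
move=> bS; rewrite /projV big_seq_fset1 (A3_coroot (starRoots_root _ bS)).
by rewrite dualVec_star.
Qed.

(** With [s g = t g - twopii * <g, lam>] the denominators are the differences
    [s g - s b]. *)
Lemma denom_star t lam b g : b \in starRoots -> g \in starRoots ->
  denom D I t lam [fset b]%fset g =
    (t g - twopii * (dot g lam)%:C) - (t b - twopii * (dot b lam)%:C).
Proof.
move=> bS gS; rewrite /denom big_seq_fset1 dualVec_star // projV_star //.
rewrite (A3_coroot (starRoots_root _ gS)) dotDr dotNr dotZr.
by rewrite dot_starRoots_weight2 // !mulr1 rmorphB /=; ring.
Qed.

Lemma sublattice_star b : b \in starRoots ->
  sublattice D I [fset b]%fset = corootLattice D.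
Proof.
move=> bS; set L := sublattice _ _ _.
have coroot_simple x : x \in A3_simple -> coroot x = x.
  by move/A3_simple_roots/A3_coroot.
have gen_simple x : x \in A3_simple -> corootLattice D x.
  move=> xS; apply: intSpan_gen; apply/imfsetP.
  have /tnthP[k xE] := xS; exists k => //=.
  by rewrite -xE coroot_simple.
have gen_full x : x \in full D I [fset b]%fset -> L x.
  move=> xV; apply: intSpan_gen; apply/imfsetP; exists x => //=.
  by rewrite (A3_coroot (full_root _ bS _ xV)).
have L1 : L (e 1 - e 2).
  by apply: gen_full; rewrite in_fsetU mem_PsiI !inE eqxx orbT.
have L3 : L (e 3 - e 4).
  by apply: gen_full; rewrite in_fsetU mem_PsiI !inE eqxx !orbT.
have Lb : L b by apply: gen_full; rewrite in_fsetU in_fset1 eqxx.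
have [k1 [k3 e23]] := starRoots_simple _ bS.
have Q1 : corootLattice D (e 1 - e 2).
  by apply: gen_simple; rewrite !inE eqxx.
have Q2 : corootLattice D (e 2 - e 3).
  by apply: gen_simple; rewrite !inE eqxx orbT.
have Q3 : corootLattice D (e 3 - e 4).
  by apply: gen_simple; rewrite !inE eqxx !orbT.
apply/seteqP; split; apply: intSpan_le => _ /imfsetP[x /= xV ->].
  rewrite (A3_coroot (full_root _ bS _ xV)); move: xV.
  rewrite in_fsetU mem_PsiI in_fset1 !inE => /or3P[] /eqP->;
    [|exact: Q1|exact: Q3].
  have -> : b = (e 2 - e 3) + ((e 1 - e 2) *~ (- k1) + (e 3 - e 4) *~ (- k3)).
    by rewrite e23 !mulrNz -opprD -[_ + _ *~ k3]addrA addrK.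
  apply: intSpanD Q2 _.
  by apply: intSpanD; [exact: intSpanMz Q1|exact: intSpanMz Q3].
rewrite coroot_simple ?mem_tnth //.
case/A3_simpleP: (mem_tnth x (@A3_simple R)) => ->;
  [exact: L1|rewrite e23|exact: L3].
apply: intSpanD; last exact: intSpanMz L3.
by apply: intSpanD Lb _; exact: intSpanMz L1.
Qed.

Lemma dot_corootLattice_weight q k :
  corootLattice D q -> dot q (weight k) \is a Num.int.
Proof.
case=> c ->; rewrite big_seq.
apply: (big_ind (fun x => dot x _ \is a Num.int)) => [|u v uZ vZ|a].
- by rewrite dot0l rpred0.
- by rewrite dotDl rpredD.
case/imfsetP => l _ ->; rewrite (A3_coroot (A3_simple_roots (mem_tnth _ _))).
rewrite -scaler_int dotZl rpredM ?rpred_int //.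
by case: l => [[|[|[|//]]] ?];
  rewrite (tnth_nth 0) /= dot_root_weight // rpredB ?rpred_nat.
Qed.

Lemma sum_bases (F : {fset 'rV[R]_4} -> R[i]) :
  \sum_(A <- bases D I) F A = \sum_(b <- starRoots) F [fset b]%fset.
Proof.
have inj_fset1 :
    {in starRoots &, injective (fun b => [fset b]%fset)}.
  by move=> ? ? _ _ /fset1_inj.
rewrite -(big_map (fun b => [fset b]%fset) xpredT F).
apply: perm_big; apply: uniq_perm.
- exact: fset_uniq.
- by rewrite map_inj_in_uniq ?starRoots_uniq.
move=> A; apply/mem_bases/mapP => -[b bS ->]; exists b => //.
Qed.

(** The general element of the lattice P_I. *)
Definition weightI (m1 m3 : int) : 'rV[R]_4 :=
  m1%:~R *: weight 1 + m3%:~R *: weight 3.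

Lemma dot_star_weightI b (m1 m3 : int) :
  b \in starRoots -> dot b (weightI m1 m3) \is a Num.int.
Proof.
move=> bS; rewrite dotDr !dotZr.
by apply: rpredD; apply: rpredM; rewrite ?rpred_int //;
  case/starRootsP: bS => ->;
  rewrite dot_root_weight // rpredB ?rpred_nat.
Qed.

(** The generating function with the fractional parts, whatever the basis,
    replaced by one number [f]. *)
Definition starSum t y lam (f : R) : R[i] :=
  let s g := t g - twopii * (dot g lam)%:C in
  \sum_(b <- starRoots)
    (\prod_(g <- starRoots | g != b) (t g / (s g - s b)))
    * (cexp (twopii * (dot y (lam - dot b lam *: weight 2))%:C)
       * (t b * cexp (t b * f%:C) / (cexp (t b) - 1))).

(** Every quotient of lattices in the sum is trivial, but its only coset is
    represented by an unspecified element [q] of the coroot lattice.  The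
    pairings of [q] with the weights are integers, so [q] drops out of the
    exponential and of the fractional part. *)
Lemma genF_star phi t y (m1 m3 : int) :
  let lam := weightI m1 m3 in
  let y2 := dot y (weight 2) in
  genF D I phi t y lam =
    starSum t y lam (if 0 < dot phi (weight 2) then fracPart y2
                         else 1 - fracPart (- y2)).
Proof.
move=> lam y2; rewrite /genF sum_bases big_seq [RHS]big_seq.
apply: eq_bigr => b bS; congr (_ * _).
  rewrite (eq_fbigl_cond _ (B := rootsStar D I) (Q := fun g => g != b)).
    rewrite (perm_big _ perm_rootsStar) big_seq_cond [RHS]big_seq_cond /=.
    by apply: eq_bigr => g /andP[gS _]; rewrite denom_star.
  by move=> g; rewrite !inE andbT andbC.
rewrite sublattice_star // latCosets_self cardfs1 divr1 mul1r big_seq_fset1.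
rewrite big_seq_fset1.
set q := cosetRepr _.
have qQ : corootLattice D q.
  by apply: xgetPex; exists 0; exists (fun=> 0); rewrite big1.
have qZ k := dot_corootLattice_weight _ k qQ.
have /intrP[k1 q1] := qZ 1%N; have /intrP[k2 q2] := qZ 2%N.
have /intrP[k3 q3] := qZ 3%N.
rewrite projV_star // /fracV dualVec_star // !dotDl q2 (opprD (dot y _)).
rewrite -[- k2%:~R]mulrNz !fracPartDint; congr (_ * _).
have /intrP[n bE] := dot_star_weightI _ m1 m3 bS.
have -> : dot q (lam - dot b lam *: weight 2) =
    (m1 * k1 + m3 * k3 - n * k2)%:~R.
  rewrite bE dotDr dotNr dotDr !dotZr q1 q2 q3.
  by rewrite rmorphB rmorphD !rmorphM.
exact: cexp_twopiiDint.
Qed.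

(** * Independence of the sign of phi on lambda_2 *)

(** Regularity makes the four nodes of the partial fractions distinct. *)
Lemma regular_star t lam b g : regular D I t lam ->
  b \in starRoots -> g \in starRoots -> g != b ->
  t g - twopii * (dot g lam)%:C != t b - twopii * (dot b lam)%:C.
Proof.
move=> treg bS gS gb; rewrite -subr_eq0 -denom_star //.
have /treg[+ _] : [fset b]%fset \in bases D I by apply/mem_bases; exists b.
by apply; rewrite in_fsetD in_fset1 gb mem_rootsStar.
Qed.

Lemma regular_cexp t lam b : regular D I t lam ->
  b \in starRoots -> cexp (t b) != 1.
Proof.
move=> treg bS.
have /treg[_] : [fset b]%fset \in bases D I by apply/mem_bases; exists b.
by apply; rewrite in_fset1.
Qed.

(** Raising [f] from 0 to 1 multiplies [cexp (t b * f)] by [cexp (t b)] and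
    thus adds [t b] to the last factor of the summand of [b].  When
    <y, weight 2> is an integer, the exponential factors are all equal, and the
    total change is zero by partial fractions. *)
Lemma starSum01 t y (m1 m3 : int) :
  let lam := weightI m1 m3 in
  regular D I t lam -> dot y (weight 2) \is a Num.int ->
  starSum t y lam 1 = starSum t y lam 0.
Proof.
move=> lam treg /intrP[k yk]; apply/eqP; rewrite -subr_eq0 -sumrB; apply/eqP.
pose s g := t g - twopii * (dot g lam)%:C.
pose E := cexp (twopii * (dot y lam)%:C).
transitivity (\sum_(b <- starRoots)
  (\prod_(g <- starRoots | g != b) (t g / (s g - s b))) * (E * t b)).
  rewrite big_seq [RHS]big_seq; apply: eq_bigr => b bS; rewrite -mulrBr.
  congr (_ * _); rewrite -mulrBr.
  have [n bn] := intrP (dot_star_weightI _ m1 m3 bS).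
  have -> : dot y (lam - dot b lam *: weight 2) = dot y lam + (- (n * k))%:~R.
    by rewrite dotDr dotNr dotZr yk bn rmorphN rmorphM.
  rewrite cexp_twopiiDint mulr1 mulr0 cexp0; congr (_ * _).
  have tb : cexp (t b) - 1 != 0 by rewrite subr_eq0 (regular_cexp _ _ _ treg).
  by field.
apply: sum_partial_fractions4; first exact: starRoots_uniq.
move=> g b gS bS sgb; apply/eqP; apply: contraT => gb.
by have := regular_star _ _ _ _ treg bS gS gb; rewrite -/(s g) sgb eqxx.
Qed.

(** For negative <phi, weight 2> the convention [1 - {-y2}] differs from [{y2}]
    only at integers [y2], where it is 1 instead of 0. *)
Lemma genF_star_frac phi t y (m1 m3 : int) :
  let lam := weightI m1 m3 in
  regular D I t lam ->
  genF D I phi t y lam = starSum t y lam (fracPart (dot y (weight 2))).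
Proof.
move=> lam treg; rewrite genF_star; case: ifP => // _.
have [yZ|yNZ] := boolP (dot y (weight 2) \is a Num.int); last first.
  by rewrite fracPartN.
have /intrP[k yk] := yZ.
by rewrite yk -mulrNz !fracPart_int subr0 starSum01.
Qed.

End TypeA3.

Theorem mainTheorem3 (R : realType) (phi : 'rV[R]_4)
    (phi_adm : admissible A3 phi)
    (y1 y2 y3 : R) (m1 m3 : int) (t : 'rV[R]_4 -> R[i]) :
  let y := y1 *: (e 1 - e 2) + y2 *: (e 2 - e 3) + y3 *: (e 3 - e 4) in
  let lam := m1%:~R *: fundWeight A3 ord0 + m3%:~R *: fundWeight A3 ord_max in
  let t13 := t (e 1 - e 3) in
  let t14 := t (e 1 - e 4) in
  let t23 := t (e 2 - e 3) in
  let t24 := t (e 2 - e 4) in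
  regular A3 A3_I t lam ->
  genF A3 A3_I phi t y lam =
    t23 / (t23 - t13 + twopii * m1%:~R)
    * (t14 / (t14 - t13 - twopii * m3%:~R))
    * (t24 / (t24 - t13 - twopii * (m3 - m1)%:~R))
    * cexp (twopii * (m1%:~R * (y1 - y2) + m3%:~R * y3)%:C)
    * (t13 * cexp (t13 * (fracPart y2)%:C) / (cexp t13 - 1))
  + t13 / (t13 - t23 - twopii * m1%:~R)
    * (t14 / (t14 - t23 - twopii * (m1 + m3)%:~R))
    * (t24 / (t24 - t23 - twopii * m3%:~R))
    * cexp (twopii * (m1%:~R * y1 + m3%:~R * y3)%:C)
    * (t23 * cexp (t23 * (fracPart y2)%:C) / (cexp t23 - 1))
  + t13 / (t13 - t24 - twopii * (m1 - m3)%:~R)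
    * (t14 / (t14 - t24 - twopii * m1%:~R))
    * (t23 / (t23 - t24 + twopii * m3%:~R))
    * cexp (twopii * (m1%:~R * y1 + m3%:~R * (y3 - y2))%:C)
    * (t24 * cexp (t24 * (fracPart y2)%:C) / (cexp t24 - 1))
  + t13 / (t13 - t14 + twopii * m3%:~R)
    * (t23 / (t23 - t14 + twopii * (m1 + m3)%:~R))
    * (t24 / (t24 - t14 + twopii * m1%:~R))
    * cexp (twopii * (m1%:~R * (y1 - y2) + m3%:~R * (y3 - y2))%:C)
    * (t14 * cexp (t14 * (fracPart y2)%:C) / (cexp t14 - 1)).
Proof.
move=> y lam t13 t14 t23 t24.
have -> : lam = weightI m1 m3 by rewrite /lam !fundWeight_A3.
move=> treg; rewrite genF_star_frac //.
have dot_y k : dot y (weight k) =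
    y1 * (k == 1%N)%:R + y2 * (k == 2%N)%:R + y3 * (k == 3%N)%:R.
  rewrite !dotDl !dotZl !dot_root_weight //.
  by case: k => [|[|[|[|k]]]]; rewrite /= ?subrr ?subr0.
have dot_root i j : (0 < i <= 4)%N -> (0 < j <= 4)%N ->
    dot (e i - e j) (weightI m1 m3) =
    m1%:~R * ((i <= 1)%:R - (j <= 1)%:R) + m3%:~R * ((i <= 3)%:R - (j <= 3)%:R).
  by move=> i4 j4; rewrite dotDr !dotZr !dot_root_weight.
have dot_yb b : dot y (weightI m1 m3 - dot b (weightI m1 m3) *: weight 2) =
    m1%:~R * y1 + m3%:~R * y3 - dot b (weightI m1 m3) * y2.
  rewrite dotDr dotNr [dot y (weightI _ _)]dotDr !dotZr !dot_y /=.
  by rewrite !mulr0 !mulr1 !addr0 !add0r.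
rewrite dot_y /= !mulr0 mulr1 addr0 add0r.
rewrite /starSum uniq4_sum_prod ?starRoots_uniq // !dot_yb !dot_root //=.
rewrite -/t13 -/t14 -/t23 -/t24 !subrr !subr0 !mulr0 !mulr1 !addr0 !add0r.
have -> : m1%:~R * y1 + m3%:~R * y3 - m1%:~R * y2 =
  m1%:~R * (y1 - y2) + m3%:~R * y3 by ring.
have -> : m1%:~R * y1 + m3%:~R * y3 - m3%:~R * y2 =
  m1%:~R * y1 + m3%:~R * (y3 - y2) by ring.
have -> : m1%:~R * y1 + m3%:~R * y3 - (m1%:~R + m3%:~R) * y2 =
  m1%:~R * (y1 - y2) + m3%:~R * (y3 - y2) by ring.
rewrite mul0r subr0 -intrD !rmorph_int !rmorphB !rmorphD rmorph0 /=.
rewrite mulr0 !subr0.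
(* In the first three summands the factors with numerators t14 and t24, or t23
   and t14, come in the opposite order. *)
congr (_ + _ + _ + _); rewrite [LHS]mulrA.
- rewrite [X in X * _ * _ = _]mulrAC.
  by congr (_ / _ * (_ / _) * (_ / _) * _ * _); ring.
- rewrite [X in X * _ * _ = _]mulrAC.
  by congr (_ / _ * (_ / _) * (_ / _) * _ * _); ring.
- rewrite [X in X * _ * _ = _]mulrAC.
  by congr (_ / _ * (_ / _) * (_ / _) * _ * _); ring.
- by congr (_ / _ * (_ / _) * (_ / _) * _ * _); ring.
Qed.
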